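(* Let $k$ be a field, let $(A,B,\varepsilon)$ be a triple over $k$, and let $M$ be an $A$-bimodule which is $B$-symmetric. Consider the sequence $$\mathrm{H}_2(A,M)\xrightarrow{\ \Phi^2\ }\mathrm{H}_2((A,B,\varepsilon);M)\xrightarrow{\ \Psi\ }\mathrm{H}_1(B,M)\xrightarrow{\ \varepsilon_*\ }\mathrm{H}_1(A,M)\xrightarrow{\ \Phi^1\ }\mathrm{H}_1((A,B,\varepsilon);M)\to 0,$$ where the maps are given on representatives by $$\Phi^2(m\otimes a\otimes b)=m\otimes\begin{pmatrix}a&1_B\\1&b\end{pmatrix},\quad \Psi\left(m\otimes\begin{pmatrix}a&\alpha\\1&b\end{pmatrix}\right)=bma\otimes\alpha,\quad \varepsilon_*(m\otimes\alpha)=m\otimes\varepsilon(\alpha),\quad \Phi^1(m\otimes a)=m\otimes a.$$ Then: (i) $\operatorname{Im}(\Phi^2)\subseteq\operatorname{Ker}(\Psi)$; (ii) $\operatorname{Ker}(\Psi)\subseteq\operatorname{Im}(\Phi^2)$; (iii) $\operatorname{Im}(\Psi)\subseteq\operatorname{Ker}(\varepsilon_* )$; (iv) $\operatorname{Ker}(\varepsilon_* )\subseteq\operatorname{Im}(\Psi)$; (v) $\operatorname{Im}(\varepsilon_* )\subseteq\operatorname{Ker}(\Phi^1)$; (vi) $\operatorname{Ker}(\Phi^1)\subseteq\operatorname{Im}(\varepsilon_* )$; (vii) $\Phi^1$ is surjective. In particular, the sequence $$\mathrm{H}_2(A,M)\xrightarrow{\ \Phi^2\ }\mathrm{H}_2((A,B,\varepsilon);M)\xrightarrow{\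 \Psi\ }\mathrm{H}_1(B,M)\xrightarrow{\ \varepsilon_*\ }\mathrm{H}_1(A,M)\xrightarrow{\ \Phi^1\ }\mathrm{H}_1((A,B,\varepsilon);M)\to 0$$ is exact.
   Context: Fix a field $k$; $\otimes=\otimes_k$, and all $k$-algebras are unital. A triple $(A,B,\varepsilon)$ over $k$ consists of an associative $k$-algebra $A$, a commutative $k$-algebra $B$, and a morphism of $k$-algebras $\varepsilon:B\to A$ with $\varepsilon(B)\subseteq\mathcal{Z}(A)$ (the center of $A$). An $A$-bimodule $M$ is $B$-symmetric if $m\varepsilon(\alpha)=\varepsilon(\alpha)m$ for all $m\in M$, $\alpha\in B$. $\mathrm{H}_\bullet(A,M)$ is the usual Hochschild homology of $A$ with coefficients in $M$, i.e. the homology of the complex $C_n(A,M)=M\otimes A^{\otimes n}$ with $$d_n(m\otimes a_1\otimes\cdots\otimes a_n)=ma_1\otimes a_2\otimes\cdots\otimes a_n+\sum_{i=1}^{n-1}(-1)^i m\otimes a_1\otimes\cdots\otimes a_ia_{i+1}\otimes\cdots\otimes a_n+(-1)^na_nm\otimes a_1\otimes\cdots\otimes a_{n-1}.$$ $\mathrm{H}_\bullet(B,M)$ is the Hochschild homology of $B$ with coefficients in $M$, where $M$ is a $B$-bimodule via $\varepsilon$. The secondary Hochschild homology $\mathrm{H}_\bullet((A,B,\varepsilon);M)$ is the homology of a chain complex with $C_n((A,B,\varepsilon);M)=M\otimes A^{\otimes n}\otimes B^{\otimes n(n-1)/2}$. In the degrees relevant for $\mathrm{H}_1$ and $\mathrm{H}_2$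 it reads $$M\otimes A^{\otimes 3}\otimes B^{\otimes 3}\xrightarrow{\ \partial_3^\varepsilon\ }M\otimes A^{\otimes 2}\otimes B\xrightarrow{\ \partial_2^\varepsilon\ }M\otimes A\xrightarrow{\ \partial_1^\varepsilon\ }M\to 0,$$ where elementary tensors are written as $m\otimes$ (an upper triangular array with entries of $A$ on the diagonal, entries of $B$ above it, and $1$ below it), and $$\partial_1^\varepsilon(m\otimes a)=ma-am,$$ $$\partial_2^\varepsilon\left(m\otimes\begin{pmatrix}a&\alpha\\1&b\end{pmatrix}\right)=ma\varepsilon(\alpha)\otimes b-m\otimes a\varepsilon(\alpha)b+b\varepsilon(\alpha)m\otimes a,$$ $$\partial_3^\varepsilon\left(m\otimes\begin{pmatrix}a&\alpha&\beta\\1&b&\gamma\\1&1&c\end{pmatrix}\right)=ma\varepsilon(\alpha\beta)\otimes\begin{pmatrix}b&\gamma\\1&c\end{pmatrix}-m\otimes\begin{pmatrix}a\varepsilon(\alpha)b&\beta\gamma\\1&c\end{pmatrix}+m\otimes\begin{pmatrix}a&\alpha\beta\\1&b\varepsilon(\gamma)c\end{pmatrix}-c\varepsilon(\beta\gamma)m\otimes\begin{pmatrix}a&\alpha\\1&b\end{pmatrix}.$$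
   Formalization: Ψ is not well defined on homology for general M (e.g. A=M=M_2(k[x]), B=k[x]); (i)–(iv) are stated with Ker Ψ and Im Ψ taken on representing cycles, and exactness is stated for any linear Ψ on homology given by the formula. *)

(* Defs.v *)
From HB Require Import structures.
From mathcomp Require Import all_boot all_algebra finmap.
From mathcomp Require Import boolp classical_sets.
From mathcomp Require Import monalg.

Set Implicit Arguments.
Unset Strict Implicit.
Unset Printing Implicit Defensive.

Import GRing.Theory.
Local Open Scope ring_scope.
Local Open Scope quotient_scope.
Local Open Scope classical_set_scope.

Section ModuleQuotient.
Variables (k : fieldType) (V : lmodType k) (S : submodClosed V).

(* [submodClosed] carries no closure under opposites, which the library's
   quotient of an additive group requires. *)
Definition submod_pred : {pred V} := S.

Fact submod_pred_zmod : zmod_closed submod_pred.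
Proof.
split=> [|x y xS yS]; first exact: (rpred0 S).
by rewrite -scaleN1r; apply: (@rpredD _ S) => //; apply: (@rpredZ _ _ S).
Qed.

HB.instance Definition _ := GRing.isZmodClosed.Build V submod_pred submod_pred_zmod.

Definition lquot := Quotient.quot submod_pred.

HB.instance Definition _ := GRing.Zmodule.on lquot.

Definition lproj (v : V) : lquot := \pi_(Quotient.quot submod_pred) v.

Lemma lproj_eq u v : (lproj u = lproj v) <-> (u - v \in S).
Proof.
by rewrite -[_ \in S]/(_ \in submod_pred) Quotient.idealrBE; split=> /eqP.
Qed.

Lemma lproj_surj (x : lquot) : lproj (repr x) = x.
Proof. exact: reprK. Qed.

Lemma lprojD : {morph lproj : u v / u + v}.
Proof. by move=> u v; rewrite /lproj !piE. Qed.

Definition lquot_scale (c : k) (x : lquot) : lquot := lproj (c *: repr x).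

Lemma lquot_scaleE c v : lquot_scale c (lproj v) = lproj (c *: v).
Proof.
apply/lproj_eq; rewrite -scalerBr; apply: (@rpredZ _ _ S).
by apply/lproj_eq; rewrite lproj_surj.
Qed.

Fact lquot_scaleA a b x : lquot_scale a (lquot_scale b x) = lquot_scale (a * b) x.
Proof. by rewrite -(lproj_surj x) !lquot_scaleE scalerA. Qed.

Fact lquot_scale1 : left_id 1 lquot_scale.
Proof. by move=> x; rewrite -(lproj_surj x) lquot_scaleE scale1r. Qed.

Fact lquot_scaleDr : right_distributive lquot_scale +%R.
Proof.
move=> a x y; rewrite -(lproj_surj x) -(lproj_surj y) -lprojD !lquot_scaleE.
by rewrite scalerDr lprojD.
Qed.

Fact lquot_scaleDl x : {morph lquot_scale^~ x : a b / a + b}.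
Proof. by move=> a b; rewrite -(lproj_surj x) !lquot_scaleE scalerDl lprojD. Qed.

HB.instance Definition _ := GRing.Zmodule_isLmodule.Build k lquot
  lquot_scaleA lquot_scale1 lquot_scaleDr lquot_scaleDl.

Fact lproj_is_linear : linear lproj.
Proof. by move=> c u v; rewrite lprojD -lquot_scaleE. Qed.

HB.instance Definition _ :=
  GRing.isLinear.Build k V lquot _ lproj lproj_is_linear.

Lemma lproj_eq0 v : (lproj v = 0) <-> (v \in S).
Proof. by rewrite -(linear0 lproj) lproj_eq subr0. Qed.

End ModuleQuotient.

Section Tensor.
Variables (k : fieldType) (V W : lmodType k).

Local Notation free := {malg k[(V * W)%type]}.

(* The submodule of the free module on V * W generated by the bilinearity
   relations. *)
Inductive bilin_rel : free -> Prop :=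
| bilin_rel0 : bilin_rel 0
| bilin_relP c x y : bilin_rel x -> bilin_rel y -> bilin_rel (c *: x + y)
| bilin_rel_l c u v w :
    bilin_rel (<< (c *: u + v, w) >> - (c *: << (u, w) >> + << (v, w) >>))
| bilin_rel_r c v w x :
    bilin_rel (<< (v, c *: w + x) >> - (c *: << (v, w) >> + << (v, x) >>)).

Definition bilin_span : {pred free} := fun x => `[< bilin_rel x >].

Fact bilin_span_closed : GRing.subsemimod_closed bilin_span.
Proof.
split; [split|].
- exact/asboolP/bilin_rel0.
- move=> x y /asboolP xr /asboolP yr; apply/asboolP.
  by rewrite -(scale1r x); apply: bilin_relP.
- move=> c x /asboolP xr; apply/asboolP.
  by rewrite -[_ *: _]addr0; apply: bilin_relP => //; apply: bilin_rel0.
Qed.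

HB.instance Definition _ :=
  GRing.isSubmodClosed.Build k free bilin_span bilin_span_closed.

Definition tensor : lmodType k := lquot bilin_span.

End Tensor.

(* Locked, so that unification never unfolds elementary tensors. *)
HB.lock Definition tens (k : fieldType) (V W : lmodType k) (v : V) (w : W) :
    tensor V W := lproj (@bilin_span k V W) << (v, w) >>.

Section TensorTheory.
Variables (k : fieldType) (V W : lmodType k).

Local Notation free := {malg k[(V * W)%type]}.
Local Notation tens := (@tens k V W).

Lemma tens_linearl w : linear (tens^~ w).
Proof.
move=> c u v; rewrite tens.unlock -linearP; apply/lproj_eq/asboolP.
exact: bilin_rel_l.
Qed.

Lemma tens_linearr v : linear (tens v).
Proof.
move=> c w x; rewrite tens.unlock -linearP; apply/lproj_eq/asboolP.
exact: bilin_rel_r.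
Qed.

Definition multilinear2 (U : lmodType k) (f : V -> W -> U) :=
  (forall w, linear (f^~ w)) /\ (forall v, linear (f v)).

(* Meaningful when f is bilinear: [lift2 f] is then the linear map sending
   [tens v w] to [f v w]; see [lift2_linear] and [lift2E]. *)
Definition lift2 (U : lmodType k) (f : V -> W -> U) (t : tensor V W) : U :=
  let g : free := repr t in \sum_(x <- msupp g) g@_x *: f x.1 x.2.

End TensorTheory.

Arguments tensor {k} (V W)%_type_scope.

Notation "V ⊗ W" := (tensor V W) (at level 40, left associativity) : type_scope.
Notation "v ⊗ w" := (tens v w) (at level 40, left associativity) : ring_scope.

Section Lift2.
Variables (k : fieldType) (V W U : lmodType k).

Let ext (f : V -> W -> U) (g : {malg k[(V * W)%type]}) : U :=
  \sum_(x <- msupp g) g@_x *: f x.1 x.2.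

Let extEw f g (d : {fset (V * W)%type}) : (msupp g `<=` d)%fset ->
  ext f g = \sum_(x <- d) g@_x *: f x.1 x.2.
Proof.
move=> le; rewrite [LHS](big_fset_incl _ le) => //= x xd /mcoeff_outdom ->.
by rewrite scale0r.
Qed.

Let ext_linear f : linear (ext f).
Proof.
move=> c x y; pose d := (msupp x `|` msupp y)%fset.
have lx : (msupp x `<=` d)%fset by apply: fsubsetUl.
have ly : (msupp y `<=` d)%fset by apply: fsubsetUr.
have lxy : (msupp (c *: x + y) `<=` d)%fset.
  apply: fsubset_trans (msuppD_le _ _) _.
  by rewrite fsubUset ly andbT (fsubset_trans (msuppZ_le _ _)).
rewrite (extEw _ lx) (extEw _ ly) (extEw _ lxy) scaler_sumr -big_split /=.
by apply: eq_bigr => z _; rewrite mcoeffD mcoeffZ scalerDl scalerA.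
Qed.

Let extU f v w : ext f << (v, w) >> = f v w.
Proof. by rewrite (extEw _ msuppU_le) big_seq_fset1 mcoeffUU scale1r. Qed.

Let ext0 f : ext f 0 = 0.
Proof. by rewrite /ext msupp0 big_seq_fset0. Qed.

Let extB f x y : ext f (x - y) = ext f x - ext f y.
Proof. by rewrite addrC -[- y]scaleN1r ext_linear scaleN1r addrC. Qed.

Let ext_rel f g : multilinear2 f -> bilin_rel g -> ext f g = 0.
Proof.
move=> [fl fr]; elim=> [|c x y _ IHx _ IHy|c u v w|c v w x]; first exact: ext0.
- by rewrite ext_linear IHx IHy scaler0 addr0.
- by rewrite extB ext_linear !extU fl subrr.
- by rewrite extB ext_linear !extU fr subrr.
Qed.

Let lift2_proj f g : multilinear2 f -> lift2 f (lproj (@bilin_span k V W) g) = ext f g.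
Proof.
move=> fm; rewrite /lift2 -/(ext f _); set r := repr _.
have /asboolP rg : r - g \in @bilin_span k V W by apply/lproj_eq; rewrite lproj_surj.
have := ext_rel fm rg; rewrite extB => /eqP.
by rewrite subr_eq0 => /eqP.
Qed.

Lemma lift2_linear (f : V -> W -> U) : multilinear2 f -> linear (lift2 f).
Proof.
move=> fm c x y; rewrite -(lproj_surj x) -(lproj_surj y) -linearP.
by rewrite !lift2_proj // ext_linear.
Qed.

Lemma lift2E (f : V -> W -> U) v w : multilinear2 f -> lift2 f (v ⊗ w) = f v w.
Proof. by move=> fm; rewrite tens.unlock lift2_proj // extU. Qed.

Lemma lift2P (f g h : V -> W -> U) c t :
  (forall v w, f v w = c *: g v w + h v w) ->
  lift2 f t = c *: lift2 g t + lift2 h t.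
Proof.
move=> e; rewrite /lift2 scaler_sumr -big_split /=; apply: eq_bigr => x _.
by rewrite e scalerDr !scalerA mulrC.
Qed.

Lemma tensor_ind (P : V ⊗ W -> Prop) :
  P 0 -> (forall c x y, P x -> P y -> P (c *: x + y)) ->
  (forall v w, P (v ⊗ w)) -> forall t, P t.
Proof.
move=> P0 PD Pt t; rewrite -(lproj_surj t) [repr t]monalgE.
elim: (msupp _ : seq _) => [|x s IHs]; first by rewrite big_nil linear0.
rewrite big_cons linearD /=.
have -> : << (repr t)@_x *g x >> = (repr t)@_x *: << x >> :> {malg k[(V * W)%type]}.
  by apply/malgP => y; rewrite mcoeffZ !mcoeffU mulr_natr.
by rewrite linearZ /=; apply: PD => //; case: x => v w; have := Pt v w; rewrite tens.unlock.
Qed.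

End Lift2.

Section Multilinear.
Variable k : fieldType.
Implicit Types V U : lmodType k.

Definition multilinear3 V1 V2 V3 U (f : V1 -> V2 -> V3 -> U) :=
  (forall x, multilinear2 (fun v1 v2 => f v1 v2 x)) /\
  (forall v1 v2, linear (f v1 v2)).
Definition multilinear4 V1 V2 V3 V4 U (f : V1 -> V2 -> V3 -> V4 -> U) :=
  (forall x, multilinear3 (fun v1 v2 v3 => f v1 v2 v3 x)) /\
  (forall v1 v2 v3, linear (f v1 v2 v3)).
Definition multilinear5 V1 V2 V3 V4 V5 U (f : V1 -> V2 -> V3 -> V4 -> V5 -> U) :=
  (forall x, multilinear4 (fun v1 v2 v3 v4 => f v1 v2 v3 v4 x)) /\
  (forall v1 v2 v3 v4, linear (f v1 v2 v3 v4)).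
Definition multilinear6 V1 V2 V3 V4 V5 V6 U
    (f : V1 -> V2 -> V3 -> V4 -> V5 -> V6 -> U) :=
  (forall x, multilinear5 (fun v1 v2 v3 v4 v5 => f v1 v2 v3 v4 v5 x)) /\
  (forall v1 v2 v3 v4 v5, linear (f v1 v2 v3 v4 v5)).
Definition multilinear7 V1 V2 V3 V4 V5 V6 V7 U
    (f : V1 -> V2 -> V3 -> V4 -> V5 -> V6 -> V7 -> U) :=
  (forall x, multilinear6 (fun v1 v2 v3 v4 v5 v6 => f v1 v2 v3 v4 v5 v6 x)) /\
  (forall v1 v2 v3 v4 v5 v6, linear (f v1 v2 v3 v4 v5 v6)).

Definition lift3 V1 V2 V3 U (f : V1 -> V2 -> V3 -> U) : V1 ⊗ V2 ⊗ V3 -> U :=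
  lift2 (fun t x => lift2 (fun v1 v2 => f v1 v2 x) t).
Definition lift4 V1 V2 V3 V4 U (f : V1 -> V2 -> V3 -> V4 -> U) :
    V1 ⊗ V2 ⊗ V3 ⊗ V4 -> U :=
  lift2 (fun t x => lift3 (fun v1 v2 v3 => f v1 v2 v3 x) t).
Definition lift5 V1 V2 V3 V4 V5 U (f : V1 -> V2 -> V3 -> V4 -> V5 -> U) :
    V1 ⊗ V2 ⊗ V3 ⊗ V4 ⊗ V5 -> U :=
  lift2 (fun t x => lift4 (fun v1 v2 v3 v4 => f v1 v2 v3 v4 x) t).
Definition lift6 V1 V2 V3 V4 V5 V6 U
    (f : V1 -> V2 -> V3 -> V4 -> V5 -> V6 -> U) :
    V1 ⊗ V2 ⊗ V3 ⊗ V4 ⊗ V5 ⊗ V6 -> U :=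
  lift2 (fun t x => lift5 (fun v1 v2 v3 v4 v5 => f v1 v2 v3 v4 v5 x) t).
Definition lift7 V1 V2 V3 V4 V5 V6 V7 U
    (f : V1 -> V2 -> V3 -> V4 -> V5 -> V6 -> V7 -> U) :
    V1 ⊗ V2 ⊗ V3 ⊗ V4 ⊗ V5 ⊗ V6 ⊗ V7 -> U :=
  lift2 (fun t x => lift6 (fun v1 v2 v3 v4 v5 v6 => f v1 v2 v3 v4 v5 v6 x) t).

Section Lift3.
Variables V1 V2 V3 U : lmodType k.
Implicit Types f g h : V1 -> V2 -> V3 -> U.

Lemma lift3P f g h c t :
  (forall v1 v2 v3, f v1 v2 v3 = c *: g v1 v2 v3 + h v1 v2 v3) ->
  lift3 f t = c *: lift3 g t + lift3 h t.
Proof. by move=> e; apply: lift2P => s x; apply: lift2P. Qed.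

Let lift3_mult f : multilinear3 f ->
  multilinear2 (fun t x => lift2 (fun v1 v2 => f v1 v2 x) t).
Proof.
move=> [fm fl]; split=> [x|t c x y]; first exact: lift2_linear.
by apply: lift2P => *; rewrite fl.
Qed.

Lemma lift3_linear f : multilinear3 f -> linear (lift3 f).
Proof. by move/lift3_mult/lift2_linear. Qed.

Lemma lift3E f v1 v2 v3 : multilinear3 f -> lift3 f (v1 ⊗ v2 ⊗ v3) = f v1 v2 v3.
Proof. by move=> fm; rewrite /lift3 (lift2E _ _ (lift3_mult fm)) lift2E; last case: fm. Qed.
End Lift3.

Section Lift4.
Variables V1 V2 V3 V4 U : lmodType k.
Implicit Types f g h : V1 -> V2 -> V3 -> V4 -> U.

Lemma lift4P f g h c t :
  (forall v1 v2 v3 v4, f v1 v2 v3 v4 = c *: g v1 v2 v3 v4 + h v1 v2 v3 v4) ->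
  lift4 f t = c *: lift4 g t + lift4 h t.
Proof. by move=> e; apply: lift2P => s x; apply: lift3P. Qed.

Let lift4_mult f : multilinear4 f ->
  multilinear2 (fun t x => lift3 (fun v1 v2 v3 => f v1 v2 v3 x) t).
Proof.
move=> [fm fl]; split=> [x|t c x y]; first exact: lift3_linear.
by apply: lift3P => *; rewrite fl.
Qed.

Lemma lift4_linear f : multilinear4 f -> linear (lift4 f).
Proof. by move/lift4_mult/lift2_linear. Qed.

Lemma lift4E f v1 v2 v3 v4 : multilinear4 f ->
  lift4 f (v1 ⊗ v2 ⊗ v3 ⊗ v4) = f v1 v2 v3 v4.
Proof. by move=> fm; rewrite /lift4 (lift2E _ _ (lift4_mult fm)) lift3E; last case: fm. Qed.
End Lift4.

Section Lift5.
Variables V1 V2 V3 V4 V5 U : lmodType k.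
Implicit Types f g h : V1 -> V2 -> V3 -> V4 -> V5 -> U.

Lemma lift5P f g h c t :
  (forall v1 v2 v3 v4 v5,
     f v1 v2 v3 v4 v5 = c *: g v1 v2 v3 v4 v5 + h v1 v2 v3 v4 v5) ->
  lift5 f t = c *: lift5 g t + lift5 h t.
Proof. by move=> e; apply: lift2P => s x; apply: lift4P. Qed.

Let lift5_mult f : multilinear5 f ->
  multilinear2 (fun t x => lift4 (fun v1 v2 v3 v4 => f v1 v2 v3 v4 x) t).
Proof.
move=> [fm fl]; split=> [x|t c x y]; first exact: lift4_linear.
by apply: lift4P => *; rewrite fl.
Qed.

Lemma lift5_linear f : multilinear5 f -> linear (lift5 f).
Proof. by move/lift5_mult/lift2_linear. Qed.

Lemma lift5E f v1 v2 v3 v4 v5 : multilinear5 f ->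
  lift5 f (v1 ⊗ v2 ⊗ v3 ⊗ v4 ⊗ v5) = f v1 v2 v3 v4 v5.
Proof. by move=> fm; rewrite /lift5 (lift2E _ _ (lift5_mult fm)) lift4E; last case: fm. Qed.
End Lift5.

Section Lift6.
Variables V1 V2 V3 V4 V5 V6 U : lmodType k.
Implicit Types f g h : V1 -> V2 -> V3 -> V4 -> V5 -> V6 -> U.

Lemma lift6P f g h c t :
  (forall v1 v2 v3 v4 v5 v6,
     f v1 v2 v3 v4 v5 v6 = c *: g v1 v2 v3 v4 v5 v6 + h v1 v2 v3 v4 v5 v6) ->
  lift6 f t = c *: lift6 g t + lift6 h t.
Proof. by move=> e; apply: lift2P => s x; apply: lift5P. Qed.

Let lift6_mult f : multilinear6 f ->
  multilinear2 (fun t x => lift5 (fun v1 v2 v3 v4 v5 => f v1 v2 v3 v4 v5 x) t).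
Proof.
move=> [fm fl]; split=> [x|t c x y]; first exact: lift5_linear.
by apply: lift5P => *; rewrite fl.
Qed.

Lemma lift6_linear f : multilinear6 f -> linear (lift6 f).
Proof. by move/lift6_mult/lift2_linear. Qed.

Lemma lift6E f v1 v2 v3 v4 v5 v6 : multilinear6 f ->
  lift6 f (v1 ⊗ v2 ⊗ v3 ⊗ v4 ⊗ v5 ⊗ v6) = f v1 v2 v3 v4 v5 v6.
Proof. by move=> fm; rewrite /lift6 (lift2E _ _ (lift6_mult fm)) lift5E; last case: fm. Qed.
End Lift6.

Section Lift7.
Variables V1 V2 V3 V4 V5 V6 V7 U : lmodType k.
Implicit Types f : V1 -> V2 -> V3 -> V4 -> V5 -> V6 -> V7 -> U.

Let lift7_mult f : multilinear7 f ->
  multilinear2 (fun t x => lift6 (fun v1 v2 v3 v4 v5 v6 => f v1 v2 v3 v4 v5 v6 x) t).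
Proof.
move=> [fm fl]; split=> [x|t c x y]; first exact: lift6_linear.
by apply: lift6P => *; rewrite fl.
Qed.

Lemma lift7_linear f : multilinear7 f -> linear (lift7 f).
Proof. by move/lift7_mult/lift2_linear. Qed.

Lemma lift7E f v1 v2 v3 v4 v5 v6 v7 : multilinear7 f ->
  lift7 f (v1 ⊗ v2 ⊗ v3 ⊗ v4 ⊗ v5 ⊗ v6 ⊗ v7) = f v1 v2 v3 v4 v5 v6 v7.
Proof. by move=> fm; rewrite /lift7 (lift2E _ _ (lift7_mult fm)) lift6E; last case: fm. Qed.
End Lift7.

End Multilinear.

Section Cycles.
Variables (k : fieldType) (Y Z : lmodType k) (d : {linear Y -> Z}).

Definition kerp : {pred Y} := fun y => d y == 0.

Fact kerp_closed : GRing.subsemimod_closed kerp.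
Proof.
split; [split|].
- exact/eqP/linear0.
- move=> x y /eqP dx /eqP dy; apply/eqP.
  by rewrite -[LHS]/(d (x + y)) linearD dx dy addr0.
- move=> c x /eqP dx; apply/eqP.
  by rewrite -[LHS]/(d (c *: x)) linearZ_LR dx scaler0.
Qed.

HB.instance Definition _ := GRing.isSubmodClosed.Build k Y kerp kerp_closed.

Record cycles := Cycle { cycle_val : Y; _ : cycle_val \in kerp }.

HB.instance Definition _ := [isSub for cycle_val].
HB.instance Definition _ := [Choice of cycles by <:].
HB.instance Definition _ := [SubChoice_isSubLmodule of cycles by <:].

Lemma cycleP (z : cycles) : d (val z) = 0.
Proof. exact/eqP/(valP z). Qed.

Lemma mem_kerp y : d y = 0 -> y \in kerp.
Proof. by move=> e; apply/eqP. Qed.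

Definition cycle_of y (dy : d y = 0) : cycles := Cycle (mem_kerp dy).

End Cycles.

Section Homology.
Variables (k : fieldType) (X Y Z : lmodType k).
Variables (d' : {linear X -> Y}) (d : {linear Y -> Z}).

Definition boundary : {pred cycles d} := fun z => `[< exists x, d' x = val z >].

Fact boundary_closed : GRing.subsemimod_closed boundary.
Proof.
split; [split|].
- by apply/asboolP; exists 0; rewrite linear0 raddf0.
- move=> y z /asboolP[u du] /asboolP[v dv]; apply/asboolP; exists (u + v).
  by rewrite linearD du dv raddfD.
- move=> c y /asboolP[u du]; apply/asboolP; exists (c *: u).
  by rewrite linearZ du linearZ.
Qed.

HB.instance Definition _ :=
  GRing.isSubmodClosed.Build k (cycles d) boundary boundary_closed.

Definition homology : lmodType k := lquot boundary.

Definition hclass (z : cycles d) : homology := lproj boundary z.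

HB.instance Definition _ := GRing.Linear.copy hclass (lproj boundary).

Lemma hclass_surj (x : homology) : hclass (repr x) = x.
Proof. exact: lproj_surj. Qed.

Lemma hclass_eq0 z : hclass z = 0 <-> exists x, d' x = val z.
Proof. by rewrite lproj_eq0; split=> [/asboolP|?]; last exact/asboolP. Qed.

End Homology.

Arguments hclass {k X Y Z} d' {d} z.

Section InducedMap.
Variables (k : fieldType) (Y1 Z1 Y2 Z2 : lmodType k).
Variables (d1 : {linear Y1 -> Z1}) (d2 : {linear Y2 -> Z2}) (f : {linear Y1 -> Y2}).
Hypothesis fcyc : forall y, d1 y = 0 -> d2 (f y) = 0.

Definition cycle_map (z : cycles d1) : cycles d2 := cycle_of (fcyc (cycleP z)).

Fact cycle_map_is_linear : linear cycle_map.
Proof. by move=> c x y; apply/val_inj; rewrite /= !linearP. Qed.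

HB.instance Definition _ :=
  GRing.isLinear.Build k (cycles d1) (cycles d2) _ cycle_map cycle_map_is_linear.

Variables (X1 X2 : lmodType k) (d1' : {linear X1 -> Y1}) (d2' : {linear X2 -> Y2}).

(* The second argument is not used by the function, but makes it independent of
   the choice of a representative, hence linear. *)
Definition hmap (_ : forall x, exists y, d2' y = f (d1' x))
    (x : homology d1' d1) : homology d2' d2 :=
  hclass d2' (cycle_map (repr x)).

Hypothesis fbnd : forall x, exists y, d2' y = f (d1' x).

Lemma hmapE z : hmap fbnd (hclass d1' z) = hclass d2' (cycle_map z).
Proof.
apply/eqP; rewrite -subr_eq0 -!linearB; apply/eqP/hclass_eq0.
have /hclass_eq0[x ex] : hclass d1' (repr (hclass d1' z) - z) = 0.
  by rewrite linearB /= hclass_surj subrr.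
by have [y ey] := fbnd x; exists y; rewrite ey ex.
Qed.

Fact hmap_is_linear : linear (hmap fbnd).
Proof.
move=> c x y; rewrite -(hclass_surj x) -(hclass_surj y) -linearP !hmapE.
by rewrite (linearP cycle_map) (linearP (@hclass _ _ _ _ d2' d2)).
Qed.

HB.instance Definition _ :=
  GRing.isLinear.Build k (homology d1' d1) (homology d2' d2) _ (hmap fbnd)
    hmap_is_linear.

End InducedMap.

(* k acts the same way on both sides: both actions are k-bilinear. *)
Record bimodule (k : fieldType) (A : algType k) (M : lmodType k) := Bimodule {
  lact : A -> M -> M;
  ract : M -> A -> M;
  lact_linearl : forall m, linear (lact^~ m);
  lact_linearr : forall a, linear (lact a);
  ract_linearl : forall a, linear (ract^~ a);
  ract_linearr : forall m, linear (ract m);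
  lact1 : forall m, lact 1 m = m;
  ract1 : forall m, ract m 1 = m;
  lactA : forall a b m, lact (a * b) m = lact a (lact b m);
  ractA : forall m a b, ract m (a * b) = ract (ract m a) b;
  lractA : forall a m b, ract (lact a m) b = lact a (ract m b)
}.

Section LinearClosure.
Variables (k : fieldType) (V W : lmodType k).
Implicit Types f g : V -> W.

Lemma linear_add f g : linear f -> linear g -> linear (fun x => f x + g x).
Proof. by move=> fl gl c x y; rewrite fl gl scalerDr addrACA. Qed.

Lemma linear_sub f g : linear f -> linear g -> linear (fun x => f x - g x).
Proof. by move=> fl gl c x y; rewrite fl gl scalerBr opprD addrACA. Qed.

End LinearClosure.

Ltac lin_sum := match goal with
  | |- linear (fun x => _ - _) => apply: linear_sub; lin_sum
  | |- linear (fun x => _ + _) => apply: linear_add; lin_sum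
  | |- _ => idtac
  end.

Ltac lin_term := let c := fresh in let x := fresh in let y := fresh in
  move=> c x y;
  do 2 rewrite ?(mulrDl, mulrDr) -?(scalerAl, scalerAr) ?linearP;
  rewrite ?(lact_linearl, lact_linearr, ract_linearl, ract_linearr);
  rewrite ?(tens_linearl, tens_linearr) //.

Section Restriction.
Variables (k : fieldType) (A : algType k) (B : comAlgType k).
Variables (eps : {lrmorphism B -> A}) (M : lmodType k) (bm : bimodule A M).

Program Definition restrict : bimodule B M :=
  @Bimodule k B M (fun b m => lact bm (eps b) m) (fun m b => ract bm m (eps b))
    _ _ _ _ _ _ _ _ _.
Next Obligation. by move=> c x y; rewrite linearP lact_linearl. Qed.
Next Obligation. by apply: lact_linearr. Qed.
Next Obligation. by apply: ract_linearl. Qed.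
Next Obligation. by move=> c x y; rewrite linearP ract_linearr. Qed.
Next Obligation. by rewrite rmorph1 lact1. Qed.
Next Obligation. by rewrite rmorph1 ract1. Qed.
Next Obligation. by rewrite rmorphM lactA. Qed.
Next Obligation. by rewrite rmorphM ractA. Qed.
Next Obligation. by rewrite lractA. Qed.

Definition B_symmetric := forall m b, ract bm m (eps b) = lact bm (eps b) m.

End Restriction.

Section Hochschild.
Variables (k : fieldType) (A : algType k) (M : lmodType k) (bm : bimodule A M).

Local Notation "a ▹ m" := (lact bm a m) (at level 38, right associativity).
Local Notation "m ◃ a" := (ract bm m a) (at level 37, left associativity).

Definition hd1_fun (m : M) (a : A) : M := m ◃ a - a ▹ m.

Definition hd2_fun (m : M) (a b : A) : M ⊗ A :=
  (m ◃ a) ⊗ b - m ⊗ (a * b) + (b ▹ m) ⊗ a.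

Definition hd3_fun (m : M) (a b c : A) : M ⊗ A ⊗ A :=
  (m ◃ a) ⊗ b ⊗ c - m ⊗ (a * b) ⊗ c + m ⊗ a ⊗ (b * c) - (c ▹ m) ⊗ a ⊗ b.

Definition hd1 : M ⊗ A -> M := lift2 hd1_fun.
Definition hd2 : M ⊗ A ⊗ A -> M ⊗ A := lift3 hd2_fun.
Definition hd3 : M ⊗ A ⊗ A ⊗ A -> M ⊗ A ⊗ A := lift4 hd3_fun.

Fact hd1_mult : multilinear2 hd1_fun.
Proof. by split=> ?; rewrite /hd1_fun; lin_sum; lin_term. Qed.

Fact hd2_mult : multilinear3 hd2_fun.
Proof. by do ![split=> *]; rewrite /hd2_fun; lin_sum; lin_term. Qed.

Fact hd3_mult : multilinear4 hd3_fun.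
Proof. by do ![split=> *]; rewrite /hd3_fun; lin_sum; lin_term. Qed.

HB.instance Definition _ :=
  GRing.isLinear.Build k (M ⊗ A)%type M _ hd1 (lift2_linear hd1_mult).
HB.instance Definition _ :=
  GRing.isLinear.Build k (M ⊗ A ⊗ A)%type (M ⊗ A)%type _ hd2 (lift3_linear hd2_mult).
HB.instance Definition _ :=
  GRing.isLinear.Build k (M ⊗ A ⊗ A ⊗ A)%type (M ⊗ A ⊗ A)%type _ hd3
    (lift4_linear hd3_mult).

Lemma hd1E m a : hd1 (m ⊗ a) = hd1_fun m a.
Proof. exact/lift2E/hd1_mult. Qed.
Lemma hd2E m a b : hd2 (m ⊗ a ⊗ b) = hd2_fun m a b.
Proof. exact/lift3E/hd2_mult. Qed.
Lemma hd3E m a b c : hd3 (m ⊗ a ⊗ b ⊗ c) = hd3_fun m a b c.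
Proof. exact/lift4E/hd3_mult. Qed.

Definition HH1 : lmodType k := homology hd2 hd1.
Definition HH2 : lmodType k := homology hd3 hd2.

End Hochschild.

Section LinearExt.
Variable k : fieldType.
Implicit Types V U : lmodType k.

Lemma linear_ext2 V1 V2 U (F G : V1 ⊗ V2 -> U) : linear F -> linear G ->
  (forall v1 v2, F (v1 ⊗ v2) = G (v1 ⊗ v2)) -> F =1 G.
Proof.
move=> Fl Gl e; apply: tensor_ind => // [|c x y ex ey]; last by rewrite Fl Gl ex ey.
by have:= Fl (- 1) 0 0; have:= Gl (- 1) 0 0; rewrite !scaleN1r oppr0 addr0 !addNr => -> ->.
Qed.

Let linear_tensl V1 V2 U (F : V1 ⊗ V2 -> U) x : linear F -> linear (fun t => F (t ⊗ x)).
Proof. by move=> Fl c u v; rewrite tens_linearl Fl. Qed.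

Lemma linear_ext3 V1 V2 V3 U (F G : V1 ⊗ V2 ⊗ V3 -> U) : linear F -> linear G ->
  (forall v1 v2 v3, F (v1 ⊗ v2 ⊗ v3) = G (v1 ⊗ v2 ⊗ v3)) -> F =1 G.
Proof.
move=> Fl Gl e; apply: linear_ext2 => // t x; move: t.
by apply: linear_ext2 => //; apply: linear_tensl.
Qed.

Lemma linear_ext4 V1 V2 V3 V4 U (F G : V1 ⊗ V2 ⊗ V3 ⊗ V4 -> U) :
  linear F -> linear G ->
  (forall v1 v2 v3 v4, F (v1 ⊗ v2 ⊗ v3 ⊗ v4) = G (v1 ⊗ v2 ⊗ v3 ⊗ v4)) -> F =1 G.
Proof.
move=> Fl Gl e; apply: linear_ext2 => // t x; move: t.
by apply: linear_ext3 => //; apply: linear_tensl.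
Qed.

Lemma linear_ext5 V1 V2 V3 V4 V5 U (F G : V1 ⊗ V2 ⊗ V3 ⊗ V4 ⊗ V5 -> U) :
  linear F -> linear G ->
  (forall v1 v2 v3 v4 v5,
     F (v1 ⊗ v2 ⊗ v3 ⊗ v4 ⊗ v5) = G (v1 ⊗ v2 ⊗ v3 ⊗ v4 ⊗ v5)) -> F =1 G.
Proof.
move=> Fl Gl e; apply: linear_ext2 => // t x; move: t.
by apply: linear_ext4 => //; apply: linear_tensl.
Qed.

Lemma linear_ext6 V1 V2 V3 V4 V5 V6 U (F G : V1 ⊗ V2 ⊗ V3 ⊗ V4 ⊗ V5 ⊗ V6 -> U) :
  linear F -> linear G ->
  (forall v1 v2 v3 v4 v5 v6,
     F (v1 ⊗ v2 ⊗ v3 ⊗ v4 ⊗ v5 ⊗ v6) = G (v1 ⊗ v2 ⊗ v3 ⊗ v4 ⊗ v5 ⊗ v6)) ->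
  F =1 G.
Proof.
move=> Fl Gl e; apply: linear_ext2 => // t x; move: t.
by apply: linear_ext5 => //; apply: linear_tensl.
Qed.

Lemma linear_ext7 V1 V2 V3 V4 V5 V6 V7 U
    (F G : V1 ⊗ V2 ⊗ V3 ⊗ V4 ⊗ V5 ⊗ V6 ⊗ V7 -> U) :
  linear F -> linear G ->
  (forall v1 v2 v3 v4 v5 v6 v7, F (v1 ⊗ v2 ⊗ v3 ⊗ v4 ⊗ v5 ⊗ v6 ⊗ v7) =
                                G (v1 ⊗ v2 ⊗ v3 ⊗ v4 ⊗ v5 ⊗ v6 ⊗ v7)) ->
  F =1 G.
Proof.
move=> Fl Gl e; apply: linear_ext2 => // t x; move: t.
by apply: linear_ext6 => //; apply: linear_tensl.
Qed.

End LinearExt.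

Section Secondary.
Variables (k : fieldType) (A : algType k) (B : comAlgType k).
Variable eps : {lrmorphism B -> A}.
Variables (M : lmodType k) (bm : bimodule A M).

Local Notation "a ▹ m" := (lact bm a m) (at level 38, right associativity).
Local Notation "m ◃ a" := (ract bm m a) (at level 37, left associativity).

(* The array (a α; 1 b) is written a ⊗ b ⊗ α, and the array
   (a α β; 1 b γ; 1 1 c) is written a ⊗ b ⊗ c ⊗ α ⊗ β ⊗ γ. *)
Definition sd1_fun (m : M) (a : A) : M := m ◃ a - a ▹ m.

Definition sd2_fun (m : M) (a b : A) (α : B) : M ⊗ A :=
  (m ◃ (a * eps α)) ⊗ b - m ⊗ (a * eps α * b) + ((b * eps α) ▹ m) ⊗ a.

Definition sd3_fun (m : M) (a b c : A) (α β γ : B) : M ⊗ A ⊗ A ⊗ B :=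
  (m ◃ (a * eps (α * β))) ⊗ b ⊗ c ⊗ γ
  - m ⊗ (a * eps α * b) ⊗ c ⊗ (β * γ)
  + m ⊗ a ⊗ (b * eps γ * c) ⊗ (α * β)
  - ((c * eps (β * γ)) ▹ m) ⊗ a ⊗ b ⊗ α.

Definition sd1 : M ⊗ A -> M := lift2 sd1_fun.
Definition sd2 : M ⊗ A ⊗ A ⊗ B -> M ⊗ A := lift4 sd2_fun.
Definition sd3 : M ⊗ A ⊗ A ⊗ A ⊗ B ⊗ B ⊗ B -> M ⊗ A ⊗ A ⊗ B := lift7 sd3_fun.

Fact sd1_mult : multilinear2 sd1_fun.
Proof. by split=> ?; rewrite /sd1_fun; lin_sum; lin_term. Qed.

Fact sd2_mult : multilinear4 sd2_fun.
Proof. by do ![split=> *]; rewrite /sd2_fun; lin_sum; lin_term. Qed.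

Fact sd3_mult : multilinear7 sd3_fun.
Proof. by do ![split=> *]; rewrite /sd3_fun; lin_sum; lin_term. Qed.

HB.instance Definition _ :=
  GRing.isLinear.Build k (M ⊗ A)%type M _ sd1 (lift2_linear sd1_mult).
HB.instance Definition _ :=
  GRing.isLinear.Build k (M ⊗ A ⊗ A ⊗ B)%type (M ⊗ A)%type _ sd2
    (lift4_linear sd2_mult).
HB.instance Definition _ :=
  GRing.isLinear.Build k (M ⊗ A ⊗ A ⊗ A ⊗ B ⊗ B ⊗ B)%type
    (M ⊗ A ⊗ A ⊗ B)%type _ sd3 (lift7_linear sd3_mult).

Lemma sd1E m a : sd1 (m ⊗ a) = sd1_fun m a.
Proof. exact/lift2E/sd1_mult. Qed.
Lemma sd2E m a b α : sd2 (m ⊗ a ⊗ b ⊗ α) = sd2_fun m a b α.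
Proof. exact/lift4E/sd2_mult. Qed.
Lemma sd3E m a b c α β γ :
  sd3 (m ⊗ a ⊗ b ⊗ c ⊗ α ⊗ β ⊗ γ) = sd3_fun m a b c α β γ.
Proof. exact/lift7E/sd3_mult. Qed.

Definition SH1 : lmodType k := homology sd2 sd1.
Definition SH2 : lmodType k := homology sd3 sd2.

End Secondary.

Lemma addr_front (V : zmodType) (x y z : V) : x + (y + z) = y + (x + z).
Proof. exact: addrCA. Qed.

(* Proves x1 + ... + xn = 0 in an abelian group by cancelling opposite terms. *)
Ltac zmod_cancel :=
  repeat match goal with
  | |- context [@tens ?k ?V ?W ?v ?w] => move: (@tens k V W v w) => ?
  | |- context [@lact ?k ?A ?M ?bm ?a ?m] => move: (@lact k A M bm a m) => ?
  | |- context [@ract ?k ?A ?M ?bm ?m ?a] => move: (@ract k A M bm m a) => ?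
  end;
  rewrite -[LHS]addr0 ?opprD ?opprK -?addrA;
  repeat match goal with
  | |- - ?t + ?r = 0 => progress repeat rewrite (addr_front _ t); rewrite addNKr
  | |- ?t + ?r = 0 => progress repeat rewrite (addr_front _ (- t)); rewrite addKr
  end; try reflexivity.

Lemma linear_zero (k : fieldType) (V W : lmodType k) : linear (fun _ : V => 0 : W).
Proof. by move=> c x y; rewrite scaler0 addr0. Qed.

Lemma linear_comp (k : fieldType) (U V W : lmodType k) (f : V -> W) (g : U -> V) :
  linear f -> linear g -> linear (fun x => f (g x)).
Proof. by move=> fl gl c x y; rewrite gl fl. Qed.

Section LinearSums.
Variables (k : fieldType) (V W : lmodType k) (f : V -> W).
Hypothesis fl : linear f.

Lemma linear_sub2 x y : f (x - y) = f x - f y.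
Proof. by rewrite addrC -scaleN1r fl scaleN1r addrC. Qed.

Lemma linear_sum3 x y z : f (x - y + z) = f x - f y + f z.
Proof. by rewrite -[x - y]scale1r fl scale1r linear_sub2. Qed.

Lemma linear_sum4 x y z t : f (x - y + z - t) = f x - f y + f z - f t.
Proof. by rewrite linear_sub2 linear_sum3. Qed.

End LinearSums.

Section HochschildComplex.
Variables (k : fieldType) (A : algType k) (M : lmodType k) (bm : bimodule A M).

Lemma hd1_hd2 x : hd1 bm (hd2 bm x) = 0.
Proof.
apply: (linear_ext3 (F := fun x => hd1 bm (hd2 bm x)) (G := fun=> 0)) => //.
- by apply: linear_comp; apply: linearP.
- exact: linear_zero.
move=> m a b; rewrite hd2E /hd2_fun (@linear_sum3 _ _ _ (hd1 bm) (linearP _)) !hd1E /hd1_fun.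
rewrite !(lactA, ractA, lractA).
zmod_cancel.
Qed.

Lemma hd2_hd3 x : hd2 bm (hd3 bm x) = 0.
Proof.
apply: (linear_ext4 (F := fun x => hd2 bm (hd3 bm x)) (G := fun=> 0)) => //.
- by apply: linear_comp; apply: linearP.
- exact: linear_zero.
move=> m a b c; rewrite hd3E /hd3_fun.
rewrite (@linear_sum4 _ _ _ (hd2 bm) (linearP _)) !hd2E /hd2_fun.
rewrite !(lactA, ractA, lractA, mulrA).
zmod_cancel.
Qed.

End HochschildComplex.

Section SecondaryComplex.
Variables (k : fieldType) (A : algType k) (B : comAlgType k).
Variable eps : {lrmorphism B -> A}.
Hypothesis eps_central : forall b a, eps b * a = a * eps b.
Variables (M : lmodType k) (bm : bimodule A M).
Hypothesis Msym : B_symmetric eps bm.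

Lemma sd1_sd2 x : sd1 bm (sd2 eps bm x) = 0.
Proof.
apply: (linear_ext4 (F := fun x => sd1 bm (sd2 eps bm x)) (G := fun=> 0)) => //.
- by apply: linear_comp; apply: linearP.
- exact: linear_zero.
move=> m a b α; rewrite sd2E /sd2_fun (@linear_sum3 _ _ _ (sd1 bm) (linearP _)) !sd1E /sd1_fun.
rewrite -!mulrA !(eps_central α) !(lactA, ractA, lractA) !Msym !lractA.
zmod_cancel.
Qed.

Lemma sd2_sd3 x : sd2 eps bm (sd3 eps bm x) = 0.
Proof.
apply: (linear_ext7 (F := fun x => sd2 eps bm (sd3 eps bm x)) (G := fun=> 0)) => //.
- by apply: linear_comp; apply: linearP.
- exact: linear_zero.
move=> m a b c α β γ; rewrite sd3E /sd3_fun.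
rewrite (@linear_sum4 _ _ _ (sd2 eps bm) (linearP _)) !sd2E /sd2_fun.
have epsM u v : eps (u * v) = eps u * eps v := rmorphM eps u v.
rewrite -!(lactA, ractA) !epsM !mulrA !lractA.
have E y z δ : z * eps δ * y = z * y * eps δ by rewrite -!mulrA eps_central.
have K y z δ : lact bm z (ract bm m (y * eps δ)) = lact bm (z * eps δ) (ract bm m y).
  by rewrite ractA Msym lactA.
rewrite !K !(E b) !(E c) !(E (eps α) _ γ, E (eps β) _ γ, E (eps α) _ β).
zmod_cancel.
Qed.

End SecondaryComplex.

Section Maps.
Variables (k : fieldType) (A : algType k) (B : comAlgType k).
Variable eps : {lrmorphism B -> A}.
Variables (M : lmodType k) (bm : bimodule A M).

Local Notation "a ▹ m" := (lact bm a m) (at level 38, right associativity).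
Local Notation "m ◃ a" := (ract bm m a) (at level 37, left associativity).
Local Notation bmB := (restrict eps bm).

Definition phi2_fun (m : M) (a b : A) : M ⊗ A ⊗ A ⊗ B := m ⊗ a ⊗ b ⊗ 1.
Definition phi3_fun (m : M) (a b c : A) : M ⊗ A ⊗ A ⊗ A ⊗ B ⊗ B ⊗ B :=
  m ⊗ a ⊗ b ⊗ c ⊗ 1 ⊗ 1 ⊗ 1.
Definition psi_fun (m : M) (a b : A) (α : B) : M ⊗ B := (b ▹ (m ◃ a)) ⊗ α.
Definition eps1_fun (m : M) (α : B) : M ⊗ A := m ⊗ eps α.
Definition eps2_fun (m : M) (α β : B) : M ⊗ A ⊗ A := m ⊗ eps α ⊗ eps β.

Fact phi2_mult : multilinear3 phi2_fun.
Proof. by do ![split=> *]; rewrite /phi2_fun; lin_term. Qed.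
Fact phi3_mult : multilinear4 phi3_fun.
Proof. by do ![split=> *]; rewrite /phi3_fun; lin_term. Qed.
Fact psi_mult : multilinear4 psi_fun.
Proof. by do ![split=> *]; rewrite /psi_fun; lin_term. Qed.
Fact eps1_mult : multilinear2 eps1_fun.
Proof. by do ![split=> *]; rewrite /eps1_fun; lin_term. Qed.
Fact eps2_mult : multilinear3 eps2_fun.
Proof. by do ![split=> *]; rewrite /eps2_fun; lin_term. Qed.

Definition phi2 : M ⊗ A ⊗ A -> M ⊗ A ⊗ A ⊗ B := lift3 phi2_fun.
Definition phi3 : M ⊗ A ⊗ A ⊗ A -> M ⊗ A ⊗ A ⊗ A ⊗ B ⊗ B ⊗ B := lift4 phi3_fun.
Definition psi : M ⊗ A ⊗ A ⊗ B -> M ⊗ B := lift4 psi_fun.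
Definition eps1 : M ⊗ B -> M ⊗ A := lift2 eps1_fun.
Definition eps2 : M ⊗ B ⊗ B -> M ⊗ A ⊗ A := lift3 eps2_fun.

HB.instance Definition _ :=
  GRing.isLinear.Build k (M ⊗ A ⊗ A)%type (M ⊗ A ⊗ A ⊗ B)%type _ phi2
    (lift3_linear phi2_mult).
HB.instance Definition _ :=
  GRing.isLinear.Build k (M ⊗ A ⊗ A ⊗ A)%type (M ⊗ A ⊗ A ⊗ A ⊗ B ⊗ B ⊗ B)%type
    _ phi3 (lift4_linear phi3_mult).
HB.instance Definition _ :=
  GRing.isLinear.Build k (M ⊗ A ⊗ A ⊗ B)%type (M ⊗ B)%type _ psi
    (lift4_linear psi_mult).
HB.instance Definition _ :=
  GRing.isLinear.Build k (M ⊗ B)%type (M ⊗ A)%type _ eps1 (lift2_linear eps1_mult).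
HB.instance Definition _ :=
  GRing.isLinear.Build k (M ⊗ B ⊗ B)%type (M ⊗ A ⊗ A)%type _ eps2
    (lift3_linear eps2_mult).

Lemma phi2E m a b : phi2 (m ⊗ a ⊗ b) = m ⊗ a ⊗ b ⊗ 1.
Proof. exact/lift3E/phi2_mult. Qed.
Lemma phi3E m a b c : phi3 (m ⊗ a ⊗ b ⊗ c) = m ⊗ a ⊗ b ⊗ c ⊗ 1 ⊗ 1 ⊗ 1.
Proof. exact/lift4E/phi3_mult. Qed.
Lemma psiE m a b α : psi (m ⊗ a ⊗ b ⊗ α) = (b ▹ (m ◃ a)) ⊗ α.
Proof. exact/lift4E/psi_mult. Qed.
Lemma eps1E m α : eps1 (m ⊗ α) = m ⊗ eps α.
Proof. exact/lift2E/eps1_mult. Qed.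
Lemma eps2E m α β : eps2 (m ⊗ α ⊗ β) = m ⊗ eps α ⊗ eps β.
Proof. exact/lift3E/eps2_mult. Qed.

Lemma sd2_phi2 x : sd2 eps bm (phi2 x) = hd2 bm x.
Proof.
apply: (linear_ext3 (F := fun x => sd2 eps bm (phi2 x)) (G := hd2 bm)).
- by apply: linear_comp; apply: linearP.
- exact: linearP.
move=> m a b; rewrite phi2E sd2E hd2E /sd2_fun /hd2_fun.
by rewrite (rmorph1 eps) !mulr1.
Qed.

Lemma sd3_phi3 x : sd3 eps bm (phi3 x) = phi2 (hd3 bm x).
Proof.
apply: (linear_ext4 (F := fun x => sd3 eps bm (phi3 x))
                    (G := fun x => phi2 (hd3 bm x))).
- by apply: linear_comp; apply: linearP.
- by apply: linear_comp; apply: linearP.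
move=> m a b c; rewrite phi3E sd3E hd3E /sd3_fun /hd3_fun.
rewrite (@linear_sum4 _ _ _ phi2 (linearP _)) !phi2E.
by rewrite !mulr1 (rmorph1 eps) !mulr1.
Qed.

Lemma hd1_eps1 x : hd1 bm (eps1 x) = hd1 bmB x.
Proof.
apply: (linear_ext2 (F := fun x => hd1 bm (eps1 x)) (G := hd1 bmB)).
- by apply: linear_comp; apply: linearP.
- exact: linearP.
by move=> m α; rewrite eps1E !hd1E.
Qed.

Lemma hd2_eps2 x : hd2 bm (eps2 x) = eps1 (hd2 bmB x).
Proof.
apply: (linear_ext3 (F := fun x => hd2 bm (eps2 x))
                    (G := fun x => eps1 (hd2 bmB x))).
- by apply: linear_comp; apply: linearP.
- by apply: linear_comp; apply: linearP.
move=> m α β; rewrite eps2E !hd2E /hd2_fun.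
rewrite (@linear_sum3 _ _ _ eps1 (linearP _)) !eps1E.
by rewrite (rmorphM eps).
Qed.

Fact phi2_cyc x : hd2 bm x = 0 -> sd2 eps bm (phi2 x) = 0.
Proof. by rewrite sd2_phi2. Qed.

Fact phi2_bnd x : exists y, sd3 eps bm y = phi2 (hd3 bm x).
Proof. by exists (phi3 x); rewrite sd3_phi3. Qed.

Fact eps1_cyc x : hd1 bmB x = 0 -> hd1 bm (eps1 x) = 0.
Proof. by rewrite hd1_eps1. Qed.

Fact eps1_bnd x : exists y, hd2 bm y = eps1 (hd2 bmB x).
Proof. by exists (eps2 x); rewrite hd2_eps2. Qed.

Fact phi1_cyc x : hd1 bm x = 0 -> sd1 bm (idfun x) = 0.
Proof. by []. Qed.

Fact phi1_bnd x : exists y, sd2 eps bm y = idfun (hd2 bm x).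
Proof. by exists (phi2 x); rewrite sd2_phi2. Qed.

Definition Phi2 : {linear HH2 bm -> SH2 eps bm} := hmap phi2_cyc phi2_bnd.
Definition eps_star : {linear HH1 bmB -> HH1 bm} := hmap eps1_cyc eps1_bnd.
Definition Phi1 : {linear HH1 bm -> SH1 eps bm} := hmap phi1_cyc phi1_bnd.

Hypothesis Msym : B_symmetric eps bm.

Lemma hd1_restrict x : hd1 bmB x = 0.
Proof.
apply: (linear_ext2 (F := hd1 bmB) (G := fun=> 0)).
- exact: linearP.
- exact: linear_zero.
by move=> m α; rewrite hd1E /hd1_fun /= Msym subrr.
Qed.

Fact psi_cyc x : sd2 eps bm x = 0 -> hd1 bmB (psi x) = 0.
Proof. by rewrite hd1_restrict. Qed.

Definition psi_class (z : cycles (sd2 eps bm)) : HH1 bmB :=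
  hclass (hd2 bmB) (cycle_map psi_cyc z).

(* For general M, psi is only defined on cycles: by [psi_sd3_commutator] it sends
   some boundaries to (bm - mb) ⊗ β modulo boundaries, which need not vanish in
   HH1 of B. So the kernel and the image of the map Psi that psi "gives on
   representatives" are taken on representatives: a class is in the kernel when
   it has a representative z with psi z a boundary, and in the image when it is
   the class of psi z for some cycle z. When psi is compatible with classes these
   are the kernel and the range of the induced map. *)
Definition Psi_ker : set (SH2 eps bm) :=
  hclass (sd3 eps bm) @` (psi_class @^-1` [set 0]).

Definition Psi_im : set (HH1 bmB) := range psi_class.

(* The explicit [@tens k M B] keeps the canonical instances syntactically equal
   to those of [psi_fun]. *)
Lemma hd2_restrictE n α β : hd2 bmB (n ⊗ α ⊗ β) =
  @tens k M B (n ◃ eps α) β - @tens k M B n (α * β) + @tens k M B (eps β ▹ n) α.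
Proof. exact: (hd2E bmB). Qed.

Lemma hd2_restrict1 n : hd2 bmB (n ⊗ 1 ⊗ 1) = @tens k M B n 1.
Proof. by rewrite hd2_restrictE mulr1 (rmorph1 eps) lact1 ract1 subrr add0r. Qed.

Lemma psi_sd3_commutator m b β : exists y,
  psi (sd3 eps bm (m ⊗ 1 ⊗ b ⊗ 1 ⊗ 1 ⊗ β ⊗ 1)) =
  (b ▹ m - m ◃ b) ⊗ β + hd2 bmB y.
Proof.
exists ((m ◃ eps β ◃ b - b ▹ eps β ▹ m) ⊗ 1 ⊗ 1); rewrite hd2_restrict1.
rewrite sd3E /sd3_fun (@linear_sum4 _ _ _ psi (linearP _)) !psiE.
rewrite !(mul1r, mulr1, rmorph1 eps, lact1, ract1).
rewrite !(@linear_sub2 _ _ _ (fun v : M => v ⊗ _) (tens_linearl _)).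
apply/eqP; rewrite -subr_eq0; apply/eqP.
zmod_cancel.
Qed.

(* When A acts symmetrically on M, psi does induce a map on homology. *)
Lemma psi_bnd : (forall a m, a ▹ m = m ◃ a) ->
  forall x, exists y, hd2 bmB y = psi (sd3 eps bm x).
Proof.
move=> sym x.
pose n m a b c := b ▹ c ▹ (m ◃ a).
pose yf m (a b c : A) (α β γ : B) : M ⊗ B ⊗ B :=
  (n m a b c ◃ eps α) ⊗ β ⊗ γ - (n m a b c ◃ eps γ) ⊗ α ⊗ β.
have ym : multilinear7 yf.
  by do ![split=> *]; rewrite /yf /n; lin_sum; lin_term.
exists (lift7 yf x); move: x.
apply: (linear_ext7 (F := fun x => hd2 bmB (lift7 yf x))
                    (G := fun x => psi (sd3 eps bm x))).
- by apply: linear_comp; [apply: linearP | apply: lift7_linear].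
- by apply: linear_comp; apply: linearP.
move=> m a b c α β γ; rewrite lift7E // sd3E /sd3_fun /yf.
rewrite (@linear_sum4 _ _ _ psi (linearP _)) !psiE.
rewrite (@linear_sub2 _ _ _ (hd2 bmB) (linearP _)) !hd2_restrictE /n.
have C y z v : y ▹ z ▹ v = z ▹ y ▹ v by rewrite sym lractA -sym.
have epsM u v : eps (u * v) = eps u * eps v := rmorphM eps u v.
rewrite !epsM -!sym !lactA !(C b a, C c a, C c b, C (eps α) a, C (eps α) b,
  C (eps α) c, C (eps β) a, C (eps β) b, C (eps β) c, C (eps β) (eps α),
  C (eps γ) a, C (eps γ) b, C (eps γ) c, C (eps γ) (eps α), C (eps γ) (eps β)).
apply/eqP; rewrite -subr_eq0; apply/eqP.
zmod_cancel.

Qed.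

End Maps.

(* Main.v *)
(* Let s be [psi_section], [s (m ⊗ α) = m ⊗ (1 α; 1 1)]. Then [psi ∘ s = id],
   and three identities hold on chains:
   - [sd2 z = hd2 w - eps1 (psi z)] for some [w];
   - [z - s (psi z)] lies in the image of [phi2] plus the image of [sd3];
   - so does [s (hd2 y)] for every Hochschild 2-chain [y] of B.
   The first gives exactness at H_1(B, M) and H_1(A, M), the other two give
   Ker Psi ⊆ Im Phi2. *)
Require Import Defs.
From HB Require Import structures.
From mathcomp Require Import all_boot all_algebra.
From mathcomp Require Import boolp classical_sets.

Set Implicit Arguments.
Unset Strict Implicit.
Unset Printing Implicit Defensive.

Import GRing.Theory.
Local Open Scope ring_scope.
Local Open Scope classical_set_scope.

(** * Range inclusions checked on elementary tensors *)

Section LinearRange.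
Variable k : fieldType.
Implicit Types U W : lmodType k.

(** The tensors that [F] sends into the range of [G] form a submodule, so a preimage may be chosen
    separately for each elementary tensor. *)
Lemma linear_range2 V1 V2 U W (F : V1 ⊗ V2 -> U) (G : W -> U) :
  linear F -> linear G ->
  (forall v1 v2, exists w, F (v1 ⊗ v2) = G w) -> forall t, exists w, F t = G w.
Proof.
move=> Fl Gl e; apply: tensor_ind => [|c x y [u eu] [v ev]|//].
- by exists 0; move: (linear_sub2 Fl 0 0) (linear_sub2 Gl 0 0); rewrite !subrr => -> ->.
- by exists (c *: u + v); rewrite Fl Gl eu ev.
Qed.

Let linear_tensl V1 V2 U (F : V1 ⊗ V2 -> U) x :
  linear F -> linear (fun t => F (t ⊗ x)).
Proof. by move=> Fl c u v; rewrite tens_linearl Fl. Qed.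

Lemma linear_range3 V1 V2 V3 U W (F : V1 ⊗ V2 ⊗ V3 -> U) (G : W -> U) :
  linear F -> linear G ->
  (forall v1 v2 v3, exists w, F (v1 ⊗ v2 ⊗ v3) = G w) ->
  forall t, exists w, F t = G w.
Proof.
move=> Fl Gl e; apply: linear_range2 => // t x; move: t.
by apply: linear_range2 => //; apply: linear_tensl.
Qed.

Lemma linear_range4 V1 V2 V3 V4 U W (F : V1 ⊗ V2 ⊗ V3 ⊗ V4 -> U) (G : W -> U) :
  linear F -> linear G ->
  (forall v1 v2 v3 v4, exists w, F (v1 ⊗ v2 ⊗ v3 ⊗ v4) = G w) ->
  forall t, exists w, F t = G w.
Proof.
move=> Fl Gl e; apply: linear_range2 => // t x; move: t.
by apply: linear_range3 => //; apply: linear_tensl.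
Qed.

End LinearRange.

(** * The section of [psi] and the chain-level identities *)

Section Chains.
Variables (k : fieldType) (A : algType k) (B : comAlgType k).
Variable eps : {lrmorphism B -> A}.
Variables (M : lmodType k) (bm : bimodule A M).

Local Notation "a ▹ m" := (lact bm a m) (at level 38, right associativity).
Local Notation "m ◃ a" := (ract bm m a) (at level 37, left associativity).
Local Notation bmB := (restrict eps bm).
Local Notation psi := (psi (B := B) bm).
Local Notation phi2 := (@phi2 k A B M).
Local Notation eps1 := (eps1 eps (M := M)).

Definition psi_section_fun (m : M) (α : B) : M ⊗ A ⊗ A ⊗ B := m ⊗ 1 ⊗ 1 ⊗ α.

Fact psi_section_mult : multilinear2 psi_section_fun.
Proof. by do ![split=> *]; rewrite /psi_section_fun; lin_term. Qed.

Definition psi_section : M ⊗ B -> M ⊗ A ⊗ A ⊗ B := lift2 psi_section_fun.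

HB.instance Definition _ :=
  GRing.isLinear.Build k (M ⊗ B)%type (M ⊗ A ⊗ A ⊗ B)%type _ psi_section
    (lift2_linear psi_section_mult).

Lemma psi_sectionE m α : psi_section (m ⊗ α) = m ⊗ 1 ⊗ 1 ⊗ α.
Proof. exact/lift2E/psi_section_mult. Qed.

Lemma psi_sectionK : cancel psi_section psi.
Proof.
apply: (linear_ext2 (F := fun x => psi (psi_section x)) (G := id)) => //.
- by apply: linear_comp; apply: linearP.
by move=> m α; rewrite psi_sectionE psiE lact1 ract1.
Qed.

(** On elementary tensors [psi (phi2 x)] has the form [n ⊗ 1], which is the Hochschild boundary of
    [n ⊗ 1 ⊗ 1]. *)
Lemma psi_phi2 x : exists y, psi (phi2 x) = hd2 bmB y.
Proof.
apply: (linear_range3 (F := fun x => psi (phi2 x)) (G := hd2 bmB)).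
- by apply: linear_comp; apply: linearP.
- exact: linearP.
by move=> m a b; exists ((b ▹ (m ◃ a)) ⊗ 1 ⊗ 1); rewrite phi2E psiE hd2_restrict1.
Qed.

(** Encodes the sum of the images of [phi2] and [sd3] as the range of a single linear map, so that
    the [linear_range] lemmas apply. *)
Definition phi2_sd3 (p : ((M ⊗ A ⊗ A) * (M ⊗ A ⊗ A ⊗ A ⊗ B ⊗ B ⊗ B))%type) :=
  phi2 p.1 + sd3 eps bm p.2.

Lemma phi2_sd3_linear : linear phi2_sd3.
Proof.
apply: (linear_add (f := fun p => phi2 p.1) (g := fun p => sd3 eps bm p.2)).
- by apply: (linear_comp (f := phi2) (g := fst)); [apply: linearP|].
- by apply: (linear_comp (f := sd3 eps bm) (g := snd)); [apply: linearP|].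
Qed.

Lemma psi_retract z : exists p, z - psi_section (psi z) = phi2_sd3 p.
Proof.
apply: (linear_range4 (F := fun z => z - psi_section (psi z)) (G := phi2_sd3)).
- by apply: linear_sub => //; apply: linear_comp; apply: linearP.
- exact: phi2_sd3_linear.
move=> m a b α; pose n := m ◃ a.
(* Modulo tensors with [B]-entry [1], the 3-chain with minus sign trades [m ⊗ a ⊗ b ⊗ α] for
   [n ⊗ 1 ⊗ b ⊗ α], and the other one trades this for [(b ▹ n) ⊗ 1 ⊗ 1 ⊗ α]. The four remaining
   faces have [B]-entry [1] and are cancelled by the [phi2] component. *)
exists (m ⊗ a ⊗ (eps α * b) - ((b * eps α) ▹ m) ⊗ a ⊗ 1
          + n ⊗ eps α ⊗ b - (n ◃ eps α) ⊗ 1 ⊗ b,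
        n ⊗ 1 ⊗ 1 ⊗ b ⊗ α ⊗ 1 ⊗ 1 - m ⊗ a ⊗ 1 ⊗ b ⊗ 1 ⊗ 1 ⊗ α).
rewrite psiE psi_sectionE /phi2_sd3 [in RHS]/fst [in RHS]/snd.
rewrite (@linear_sum4 _ _ _ phi2 (linearP _)).
rewrite (@linear_sub2 _ _ _ (sd3 eps bm) (linearP _)).
rewrite !phi2E !sd3E /sd3_fun.
rewrite !(mul1r, mulr1, rmorph1 eps, lact1, ract1) /n.
apply/eqP; rewrite -subr_eq0; apply/eqP.
zmod_cancel.
Qed.

Lemma psi_section_hd2 y : exists p, psi_section (hd2 bmB y) = phi2_sd3 p.
Proof.
apply: (linear_range3 (F := fun y => psi_section (hd2 bmB y)) (G := phi2_sd3)).
- by apply: linear_comp; apply: linearP.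
- exact: phi2_sd3_linear.
move=> n α β.
(* The two 3-chains share the face [n ⊗ eps α ⊗ 1 ⊗ β], which cancels in their difference. The other
   faces are the three terms of the left-hand side and three tensors with [B]-entry [1], which the
   [phi2] component removes. *)
exists ((n ◃ eps (α * β)) ⊗ 1 ⊗ 1 - n ⊗ eps α ⊗ eps β
          + (eps β ▹ n) ⊗ eps α ⊗ 1,
        n ⊗ eps α ⊗ 1 ⊗ 1 ⊗ 1 ⊗ 1 ⊗ β - n ⊗ 1 ⊗ 1 ⊗ 1 ⊗ α ⊗ β ⊗ 1).
rewrite hd2_restrictE (@linear_sum3 _ _ _ psi_section (linearP _)) !psi_sectionE.
rewrite /phi2_sd3 [in RHS]/fst [in RHS]/snd.
rewrite (@linear_sum3 _ _ _ phi2 (linearP _)).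
rewrite (@linear_sub2 _ _ _ (sd3 eps bm) (linearP _)).
rewrite !phi2E !sd3E /sd3_fun.
rewrite !(mul1r, mulr1, rmorph1 eps, lact1, ract1).
apply/eqP; rewrite -subr_eq0; apply/eqP.
zmod_cancel.
Qed.

Hypothesis eps_central : forall b a, eps b * a = a * eps b.

Lemma sd2_psi z : exists w, sd2 eps bm z + eps1 (psi z) = hd2 bm w.
Proof.
apply: (linear_range4 (F := fun z => sd2 eps bm z + eps1 (psi z)) (G := hd2 bm)).
- by apply: linear_add; [|apply: linear_comp]; apply: linearP.
- exact: linearP.
(* The triple product [a * eps α * b] is split in two stages; the intermediate term
   [(m ◃ a) ⊗ (eps α * b)] cancels between the two boundaries. *)
move=> m a b α; exists (m ⊗ a ⊗ (eps α * b) + (m ◃ a) ⊗ eps α ⊗ b).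
rewrite sd2E psiE eps1E linearD /= !hd2E /sd2_fun /hd2_fun.
rewrite -!mulrA !(eps_central α b) !(lactA, ractA).
apply/eqP; rewrite -subr_eq0; apply/eqP.
zmod_cancel.
Qed.

(** Shows that [eps1 x] is a secondary boundary up to a Hochschild boundary. *)
Lemma sd2_psi_section x :
  exists w, sd2 eps bm (psi_section x) + eps1 x = hd2 bm w.
Proof. by have := sd2_psi (psi_section x); rewrite (psi_sectionK x). Qed.

End Chains.

(** * Equality of homology classes *)

Section Homology.
Variables (k : fieldType) (X Y Z : lmodType k).
Variables (d' : {linear X -> Y}) (d : {linear Y -> Z}).

Lemma hclass_eq (y z : cycles d) :
  (exists x, d' x = val y - val z) -> hclass d' y = hclass d' z.
Proof.
by move=> [x ex]; apply/lproj_eq/asboolP; exists x; rewrite ex raddfB.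
Qed.

End Homology.

(** * Passage to homology and exactness at each term *)

Section Exactness.
Variables (k : fieldType) (A : algType k) (B : comAlgType k).
Variable eps : {lrmorphism B -> A}.
Hypothesis eps_central : forall b a, eps b * a = a * eps b.
Variables (M : lmodType k) (bm : bimodule A M).
Hypothesis Msym : B_symmetric eps bm.

Local Notation bmB := (restrict eps bm).
Local Notation psi := (psi (B := B) bm).
Local Notation phi2 := (@phi2 k A B M).
Local Notation eps1 := (eps1 eps (M := M)).
Local Notation Phi2 := (Phi2 eps bm).
Local Notation Phi1 := (Phi1 eps bm).
Local Notation eps_star := (eps_star eps bm).

Lemma Phi2E z : Phi2 (hclass (hd3 bm) z) =
  hclass (sd3 eps bm) (Defs.cycle_map (@phi2_cyc k A B eps M bm) z).
Proof. exact: hmapE. Qed.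

Lemma eps_starE z : eps_star (hclass (hd2 bmB) z) =
  hclass (hd2 bm) (Defs.cycle_map (@eps1_cyc k A B eps M bm) z).
Proof. exact: hmapE. Qed.

Lemma Phi1E z : Phi1 (hclass (hd2 bm) z) =
  hclass (sd2 eps bm) (Defs.cycle_map (@phi1_cyc k A M bm) z).
Proof. exact: hmapE. Qed.

Lemma psi_class_eq0 z :
  psi_class Msym z = 0 <-> exists y, hd2 bmB y = psi (val z).
Proof. exact: hclass_eq0. Qed.

Lemma range_Phi2_sub : range Phi2 `<=` Psi_ker Msym.
Proof.
move=> _ [x _ <-]; rewrite -(hclass_surj x) Phi2E; set z := Defs.cycle_map _ _.
exists z => //; apply/psi_class_eq0.
by have [y ey] := psi_phi2 eps bm (val (repr x)); exists y.
Qed.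

(** If [psi z] is a boundary, both summands of [z = (z - s (psi z)) + s (psi z)] lie in the image of
    [phi2] plus that of [sd3]. *)
Lemma Psi_ker_sub : Psi_ker Msym `<=` range Phi2.
Proof.
move=> _ [z /psi_class_eq0[y ey] <-].
have [q eq] := psi_section_hd2 eps bm y.
have [r er] := psi_retract eps bm (val z).
rewrite -ey eq in er.
have [[w u] ez] : exists p, val z = phi2_sd3 eps bm p.
  by exists (1 *: r + q); rewrite phi2_sd3_linear scale1r -er subrK.
have ew : phi2 w = val z - sd3 eps bm u by rewrite ez addrK.
(* The [phi2] part comes from a Hochschild cycle: [sd2] turns [phi2 w] into [hd2 w] and kills both
   [z] and [sd3 u]. *)
have hw : hd2 bm w = 0.
  rewrite -(sd2_phi2 eps bm) ew (@linear_sub2 _ _ _ (sd2 eps bm) (linearP _)).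
  by rewrite (sd2_sd3 eps_central Msym) subr0 cycleP.
exists (hclass (hd3 bm) (cycle_of hw)) => //.
rewrite Phi2E; apply/esym/hclass_eq; exists u.
by rewrite -[LHS]/(sd3 eps bm u) -[RHS]/(val z - phi2 w) ez addrC addKr.
Qed.

(** For a secondary cycle [z], the identity [sd2_psi] reduces to [eps1 (psi z) = hd2 w]. *)
Lemma Psi_im_sub : Psi_im Msym `<=` eps_star @^-1` [set 0].
Proof.
move=> _ [z _ <-]; suff: eps_star (psi_class Msym z) = 0 by [].
rewrite eps_starE; apply/hclass_eq0.
have [w ew] := sd2_psi bm eps_central (val z).
by exists w; rewrite -[LHS]/(hd2 bm w) -ew cycleP add0r.
Qed.

Lemma ker_eps_star_sub : eps_star @^-1` [set 0] `<=` Psi_im Msym.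
Proof.
move=> x ex; have {ex} : eps_star x = 0 by [].
rewrite -(hclass_surj x) eps_starE => /hclass_eq0[y ey].
set c := repr x in ey *.
have [w ew] := sd2_psi_section bm eps_central (val c).
(* From [eps1 c = hd2 y] follows [sd2 (s c) = hd2 (w - y)]. Subtracting [phi2 (w - y)] therefore
   makes [s c] a cycle, and by [psi_phi2] it changes [psi (s c) = c] only by a boundary. *)
pose z := psi_section A (val c) - phi2 (w - y).
have hz : sd2 eps bm z = 0.
  rewrite /z (@linear_sub2 _ _ _ (sd2 eps bm) (linearP _)) sd2_phi2.
  rewrite (@linear_sub2 _ _ _ (hd2 bm) (linearP _)) -ew ey.
  by rewrite [val _]/= addrK subrr.
exists (cycle_of hz) => //; apply/esym/hclass_eq.
have [v ev] := psi_phi2 eps bm (w - y); exists v.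
rewrite -[LHS]/(hd2 bmB v) -ev -[RHS]/(val c - psi z).
by rewrite (@linear_sub2 _ _ _ psi (linearP _)) (psi_sectionK bm (val c)) subKr.
Qed.

Lemma range_eps_star_sub : range eps_star `<=` Phi1 @^-1` [set 0].
Proof.
move=> _ [x _ <-]; suff: Phi1 (eps_star x) = 0 by [].
rewrite -(hclass_surj x) (eps_starE (repr x)) Phi1E; apply/hclass_eq0.
have [w ew] := sd2_psi_section bm eps_central (val (repr x)).
(* Its [sd2] is [hd2 w - sd2 (s c)], which is [eps1 c], for [c] the chosen representative. *)
exists (phi2 w - psi_section A (val (repr x))).
rewrite -[LHS]/(sd2 eps bm (phi2 w - _)) -[RHS]/(eps1 (val (repr x))).
rewrite (@linear_sub2 _ _ _ (sd2 eps bm) (linearP _)) sd2_phi2 -ew.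
by rewrite addrC addKr.
Qed.

Lemma ker_Phi1_sub : Phi1 @^-1` [set 0] `<=` range eps_star.
Proof.
move=> x ex; have {ex}: Phi1 x = 0 by [].
rewrite -(hclass_surj x) Phi1E => /hclass_eq0[z ez].
set c := repr x in ez *.
have [w ew] := sd2_psi bm eps_central z.
(* With [c = sd2 z], [sd2_psi] makes [c] homologous to [eps1 (- psi z)]. By symmetry of [M] over
   [B], every 1-chain of [B] is a cycle. *)
exists (hclass (hd2 bmB) (cycle_of (hd1_restrict Msym (- psi z)))) => //.
rewrite eps_starE; apply/esym/hclass_eq; exists w.
rewrite -[LHS]/(hd2 bm w) -[RHS]/(val c - eps1 (- psi z)) -ew ez.
by rewrite (linearN eps1) opprK.
Qed.

Lemma range_Phi1 : range Phi1 = [set: SH1 eps bm].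
Proof.
apply/seteqP; split=> // x _; rewrite -(hclass_surj x).
(* [hd1] and [sd1] are the same map up to conversion, so the 1-cycles agree and [Phi1] only enlarges
   the boundaries. *)
have hx : hd1 bm (val (repr x)) = 0 by exact: (cycleP (repr x)).
exists (hclass (hd2 bm) (cycle_of hx)) => //.
by rewrite Phi1E; apply/hclass_eq; exists 0; rewrite (linear0 (sd2 eps bm)) subrr.
Qed.

End Exactness.

Theorem proposition3p5 (k : fieldType) (A : algType k) (B : comAlgType k)
    (eps : {lrmorphism B -> A})
    (eps_central : forall (b : B) (a : A), eps b * a = a * eps b)
    (M : lmodType k) (bm : bimodule A M) (Msym : B_symmetric eps bm) :
  (* (i)-(vii), with Ker Psi and Im Psi taken on representatives *)
  [/\ range (Phi2 eps bm) `<=` Psi_ker Msym,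
      Psi_ker Msym `<=` range (Phi2 eps bm),
      Psi_im Msym `<=` eps_star eps bm @^-1` [set 0] &
      eps_star eps bm @^-1` [set 0] `<=` Psi_im Msym] /\
  [/\ range (eps_star eps bm) `<=` Phi1 eps bm @^-1` [set 0],
      Phi1 eps bm @^-1` [set 0] `<=` range (eps_star eps bm) &
      range (Phi1 eps bm) = [set: SH1 eps bm]] /\
  (* exactness of the sequence of linear maps, for Psi given on representatives *)
  (forall Psi : {linear SH2 eps bm -> HH1 (restrict eps bm)},
     (forall z : cycles (sd2 eps bm),
        Psi (hclass (sd3 eps bm) z) = psi_class Msym z) ->
     [/\ range (Phi2 eps bm) = Psi @^-1` [set 0],
         range Psi = eps_star eps bm @^-1` [set 0],
         range (eps_star eps bm) = Phi1 eps bm @^-1` [set 0] &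
         range (Phi1 eps bm) = [set: SH1 eps bm]]).
Proof.
have imPhi2 : range (Phi2 eps bm) = Psi_ker Msym.
  by apply/seteqP; split; [apply: range_Phi2_sub | apply: Psi_ker_sub].
have kerEps : eps_star eps bm @^-1` [set 0] = Psi_im Msym.
  by apply/seteqP; split; [apply: ker_eps_star_sub | apply: Psi_im_sub].
have kerPhi1 : Phi1 eps bm @^-1` [set 0] = range (eps_star eps bm).
  by apply/seteqP; split; [apply: ker_Phi1_sub | apply: range_eps_star_sub].
split; first by rewrite imPhi2 kerEps; split.
split; first by rewrite kerPhi1; split=> //; apply: range_Phi1.
move=> Psi ePsi.
(* Every class is that of its [repr], so the kernel and range of such a [Psi] are the sets defined
   on representatives. *)
have kerPsi : Psi @^-1` [set 0] = Psi_ker Msym.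
  apply/seteqP; split=> [x ex|_ [z ez <-]].
    exists (repr x); last exact: hclass_surj.
    suff: psi_class Msym (repr x) = 0 by [].
    by rewrite -ePsi hclass_surj.
  suff: Psi (hclass (sd3 eps bm) z) = 0 by [].
  by rewrite ePsi.
have imPsi : range Psi = Psi_im Msym.
  apply/seteqP; split=> [_ [x _ <-]|_ [z _ <-]].
    by exists (repr x) => //; rewrite -ePsi hclass_surj.
  by rewrite -ePsi; exists (hclass (sd3 eps bm) z).
by rewrite imPhi2 kerPsi imPsi kerEps kerPhi1; split=> //; apply: range_Phi1.
Qed.
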